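(* Let $1<q<\infty$ and let $q'=\frac{q}{q-1}$. Then for all sequences $(a_n)_{n\in\mathbb{N}}\in\ell_q$ of nonnegative real numbers, $$\sum_{n=1}^\infty a_n\leq 2(2q'-1)^{-\frac{1}{q'}}\sum_{n=1}^\infty\left(\frac{1}{n}\sum_{k=n}^\infty a_k^q\right)^{\frac{1}{q}}.$$
   Context: $\mathbb{N}=\{1,2,3,\ldots\}$. Sums of nonnegative terms take values in $[0,\infty]$. $\ell_q$ is the space of sequences $(a_n)_{n\in\mathbb{N}}$ with $\sum_n |a_n|^q<\infty$. *)

(* Defs.v *)
(* MathComp-Analysis, over an arbitrary R : realType. *)
From HB Require Import structures.
From mathcomp Require Import all_boot all_order all_algebra.
From mathcomp Require Import all_classical all_reals all_analysis.

Set Implicit Arguments.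
Unset Strict Implicit.
Unset Printing Implicit Defensive.

Import Order.TTheory GRing.Theory Num.Theory.

Local Open Scope ring_scope.

(* Sequences indexed by {1, 2, 3, ...} are functions nat -> R whose value at 0
   is irrelevant: sums start at 1 and conditions on terms are for 1 <= n. *)
Definition ell (R : realType) (q : R) : set (nat -> R) :=
  [set a | (\sum_(1 <= n <oo) (`|a n| `^ q)%:E < +oo)%E].

(* Main.v *)
Require Import Defs.
From HB Require Import structures.
From mathcomp Require Import all_boot all_order all_algebra.
From mathcomp Require Import all_classical all_reals all_analysis.
From mathcomp Require Import ring lra.

Set Implicit Arguments.
Unset Strict Implicit.
Unset Printing Implicit Defensive.

Import Order.TTheory GRing.Theory Num.Theory.

Local Open Scope ring_scope.

(** Write [p] for the exponent conjugate to [q].  The numbers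
    [w k n = 2 n / (k (k + 1))], for [1 <= n <= k], sum to [1] over [n], so each
    [a k] can be spread over the indices [n <= k] with these weights.  Exchanging
    the two sums turns [\sum_k a k] into the sum over [n] of the weighted tails
    [\sum_(k >= n) a k * w k n] ([sum_eq_weighted_tails]).  By Hoelder such a tail
    is at most the [l_q] norm of the tail of [a] times
    [2 n (\sum_(k >= n) (k (k + 1))^-p)^(1/p)].  The last sum is controlled by
    Jensen: [1 / (k (k + 1))] is the integral of [x^-2] over [[k, k + 1]], hence
    its [p]-th power is at most the integral of [x^(-2p)], and these integrals add
    up to at most [n^(1 - 2p) / (2p - 1)] ([sum_powR_mul_succ_le]).  Collecting
    the powers of [n] leaves [n^(-1/q)] and the constant of the theorem.

    All the work is done on finite sums, where exchanging the order of summation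
    is free; a series enters only as an upper bound of its partial sums. *)

Lemma hoelder_big_nat (R : realType) (p q : R) (x y : nat -> R) (m n : nat) :
  0 < p -> 0 < q -> p^-1 + q^-1 = 1 ->
  (forall k, (m <= k)%N -> 0 <= x k) -> (forall k, (m <= k)%N -> 0 <= y k) ->
  \sum_(m <= k < n) x k * y k <=
  (\sum_(m <= k < n) x k `^ p) `^ p^-1 * (\sum_(m <= k < n) y k `^ q) `^ q^-1.
Proof.
move=> p0 q0 pq x0 y0; elim: n => [|n IHn].
  by rewrite !big_geq// mulr_ge0 ?powR_ge0.
have [mn|nm] := leqP m n; last by rewrite !big_geq// mulr_ge0 ?powR_ge0.
rewrite !big_nat_recr//=.
set A := \sum_(m <= k < n) x k `^ p; set B := \sum_(m <= k < n) y k `^ q.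
have A0 : 0 <= A by apply: sumr_ge0 => k _; exact: powR_ge0.
have B0 : 0 <= B by apply: sumr_ge0 => k _; exact: powR_ge0.
have := hoelder2 (powR_ge0 A p^-1) (x0 n mn) (powR_ge0 B q^-1) (y0 n mn)
  p0 q0 pq.
rewrite -!powRrM !mulVf ?gt_eqF// !powRr1//.
by apply: le_trans; rewrite lerD2r.
Qed.

(** Jensen's bound for [x^-2] on an interval, in logarithmic form: [t] is the
    logarithm of the ratio of the endpoints.  Both sides vanish at [t = 0]; after
    division by [expR t] the difference of the derivatives is a combination of
    [expR ((p - 1) * t)] and [expR (- p * t)] with nonnegative coefficients [p]
    and [p - 1], and in the tangent-line bound [1 + u <= expR u] for these the
    linear terms cancel. *)
Lemma expR_sub_ge (R : realType) (p t : R) : 1 <= p -> 0 <= t ->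
  (2 * p - 1) * (expR t - 1) <= expR (p * t) - expR ((1 - p) * t).
Proof.
move=> p1 t0.
pose h (s : R) := expR (p * s) - expR ((1 - p) * s) - (2 * p - 1) * expR s.
have dh (s : R) : is_derive s 1 h
    (p * expR (p * s) - (1 - p) * expR ((1 - p) * s) - (2 * p - 1) * expR s).
  apply: is_derive_eq.
  by rewrite /GRing.scale/=; ring.
have hmono : h 0 <= h t.
  apply: (@ger0_derive1_ndecry R h 0) => //.
  - move=> s; rewrite in_itv/= andbT => s0.
    rewrite derive1E derive_val.
    have -> : p * s = s + (p - 1) * s by ring.
    have -> : (1 - p) * s = s + (- p) * s by ring.
    rewrite !expRD.
    have -> : p * (expR s * expR ((p - 1) * s)) -
        (1 - p) * (expR s * expR (- p * s)) - (2 * p - 1) * expR s =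
      expR s * (p * (expR ((p - 1) * s) - (1 + (p - 1) * s)) +
        (p - 1) * (expR (- p * s) - (1 + - p * s))) by ring.
    rewrite mulr_ge0 ?expR_ge0// addr_ge0// mulr_ge0 ?subr_ge0 ?expR_ge1Dx//.
    lra.
  - by apply: derivable_within_continuous => s _; case: (dh s).
move: hmono; rewrite /h !mulr0 expR0; lra.
Qed.

(** The right-hand side is [2 p - 1] times the integral of [y^(-2p)] over
    [[x, x + 1]]. *)
Lemma powR_mul_succ_le (R : realType) (p x : R) : 1 <= p -> 0 < x ->
  (2 * p - 1) * (x * (x + 1))^-1 `^ p <= x `^ (1 - 2 * p) - (x + 1) `^ (1 - 2 * p).
Proof.
move=> p1 x0.
have y0 : 0 < x + 1 by lra.
have t0 : 0 <= ln (x + 1) - ln x.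
  by rewrite subr_ge0 ler_ln ?posrE//; lra.
have := expR_sub_ge p1 t0.
set u := ln x; set v := ln (x + 1).
have eu : expR u = x by rewrite lnK ?posrE.
have ev : expR v = x + 1 by rewrite lnK ?posrE.
have powE (s r : R) : expR s `^ r = expR (r * s).
  by rewrite -expRM mulrC.
have -> : (x * (x + 1))^-1 = expR (- (u + v)) by rewrite expRN expRD eu ev.
rewrite -ev -eu !powE => H.
(* [expR (v - u) - 1] is [x^-1], which exposes the factor common to both sides. *)
have -> : expR (p * - (u + v)) =
    expR (u - p * (u + v)) * (expR (v - u) - 1).
  rewrite (expRB v u) ev eu.
  have -> : expR (u - p * (u + v)) = x * expR (p * - (u + v)).
    by rewrite expRD eu; congr (_ * expR _); ring.
  by field; lra.
have -> : (1 - 2 * p) * u = (u - p * (u + v)) + p * (v - u) by ring.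
have -> : (1 - 2 * p) * v = (u - p * (u + v)) + (1 - p) * (v - u) by ring.
rewrite ![expR (_ + _ * (v - u))]expRD -mulrBr mulrCA.
by rewrite ler_pM2l ?expR_gt0.
Qed.

Lemma sum_powR_mul_succ_le (R : realType) (p : R) (n N : nat) :
  1 <= p -> (0 < n)%N ->
  \sum_(n <= k < N) ((k%:R * (k%:R + 1))^-1 : R) `^ p <=
  n%:R `^ (1 - 2 * p) / (2 * p - 1).
Proof.
move=> p1 n0.
have p0 : 0 < 2 * p - 1 by lra.
have [Nn|nN] := leqP N n.
  by rewrite big_geq// divr_ge0 ?powR_ge0// ltW.
rewrite ler_pdivlMr// mulrC mulr_sumr.
apply: (@le_trans _ _ (\sum_(n <= k < N)
    (- (k.+1%:R `^ (1 - 2 * p)) - - (k%:R `^ (1 - 2 * p))))).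
  apply: ler_sum_nat => k /andP[nk _].
  rewrite opprK [leRHS]addrC -(natr1 k); apply: powR_mul_succ_le => //.
  by rewrite ltr0n (leq_trans n0 nk).
rewrite (@telescope_sumr R n N (fun k => - (k%:R `^ (1 - 2 * p))) (ltnW nN)).
by rewrite opprK addrC gerBl powR_ge0.
Qed.

(** Hoelder applied to [a k] and [(k (k + 1))^-1]; the factor [n] of the weight
    combines with [n^((1 - 2p)/p)] into [n^(-1/q)]. *)
Lemma sum_tail_weight_le (R : realType) (p q : R) (a : nat -> R) (n N : nat) :
  1 <= p -> 0 < q -> p^-1 + q^-1 = 1 -> (0 < n)%N ->
  (forall k, (n <= k)%N -> 0 <= a k) ->
  \sum_(n <= k < N) a k * (2 * n%:R / (k%:R * (k%:R + 1))) <=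
  2 * (2 * p - 1) `^ (- p^-1) *
    (n%:R^-1 * \sum_(n <= k < N) a k `^ q) `^ q^-1.
Proof.
move=> p1 q0 pq n0 a0.
have p0 : 0 < p by lra.
have n0R : 0 < n%:R :> R by rewrite ltr0n.
have T0 : 0 <= \sum_(n <= k < N) a k `^ q.
  by apply: sumr_ge0 => k _; exact: powR_ge0.
have c0 : 0 < 2 * p - 1 by lra.
set T := \sum_(n <= k < N) a k `^ q in T0 *.
pose v k : R := (k%:R * (k%:R + 1))^-1.
rewrite (eq_bigr (fun k => 2 * n%:R * (a k * v k))); last first.
  by move=> k _; rewrite mulrCA.
rewrite -mulr_sumr.
have H : \sum_(n <= k < N) a k * v k <=
    T `^ q^-1 * (n%:R `^ (1 - 2 * p) / (2 * p - 1)) `^ p^-1.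
  apply: le_trans (hoelder_big_nat _ q0 p0 _ a0 _) _; first by rewrite addrC.
    by move=> k _; rewrite invr_ge0 mulr_ge0 ?addr_ge0.
  rewrite ler_wpM2l ?powR_ge0// ge0_ler_powR ?invr_ge0 ?nnegrE ?(ltW p0)//.
  - by apply: sumr_ge0 => k _; exact: powR_ge0.
  - by rewrite divr_ge0 ?powR_ge0 ?ltW.
  - exact: sum_powR_mul_succ_le.
apply: (le_trans (ler_wpM2l _ H)); first by rewrite mulr_ge0.
have cE : (2 * p - 1)^-1 `^ p^-1 = (2 * p - 1) `^ (- p^-1).
  by rewrite -powR_inv1 ?ltW// -powRrM mulN1r.
have nE : n%:R * (n%:R `^ (1 - 2 * p)) `^ p^-1 = n%:R^-1 `^ q^-1 :> R.
  rewrite -[n%:R^-1]powR_inv1// -!powRrM -{1}(powRr1 (ler0n R n)) -powRD.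
    congr (_ `^ _); have -> : q^-1 = 1 - p^-1 by rewrite -pq addrC addKr.
    by field; lra.
  by rewrite (gt_eqF n0R) implybT.
rewrite !powRM ?powR_ge0 ?invr_ge0 ?ler0n ?(ltW c0)// cE -nE.
rewrite le_eqVlt; apply/orP; left; apply/eqP; ring.
Qed.

Lemma sum_weight_eq1 (R : realType) (k : nat) : (0 < k)%N ->
  \sum_(1 <= n < k.+1) (2 * n%:R / (k%:R * (k%:R + 1))) = 1 :> R.
Proof.
move=> k0.
have k0R : 0 < k%:R :> R by rewrite ltr0n.
rewrite -mulr_suml.
have -> : \sum_(1 <= n < k.+1) 2 * n%:R = k%:R * (k%:R + 1) :> R.
  elim: k {k0 k0R} => [|k IH]; first by rewrite big_geq// mul0r.
  by rewrite big_nat_recr//= IH -natr1; ring.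
by rewrite divff// gt_eqF// mulr_gt0// addr_gt0.
Qed.

Lemma sum_eq_weighted_tails (R : realType) (a : nat -> R) (N : nat) :
  \sum_(1 <= k < N) a k =
  \sum_(1 <= n < N)
    \sum_(n <= k < N) a k * (2 * n%:R / (k%:R * (k%:R + 1))).
Proof.
transitivity (\sum_(1 <= k < N) \sum_(1 <= n < N | (n <= k)%N)
    a k * (2 * n%:R / (k%:R * (k%:R + 1)))).
  apply: eq_big_nat => k /andP[k0 kN].
  rewrite -mulr_sumr -[LHS]mulr1; congr (_ * _).
  by rewrite -(big_nat_widen _ _ _ xpredT _ kN) sum_weight_eq1.
rewrite (exchange_big_dep_nat xpredT)//=.
by apply: eq_big_nat => n /andP[n0 _]; rewrite [RHS](big_nat_widenl _ _ _ _ _ n0).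
Qed.

Theorem mainTheorem2 (R : realType) (q : R) (hq : 1 < q) :
  let q' := q / (q - 1) in
  forall a : nat -> R, ell q a -> (forall n : nat, (1 <= n)%N -> 0 <= a n) ->
  (\sum_(1 <= n <oo) (a n)%:E <=
   (2 * (2 * q' - 1) `^ (- (1 / q')))%:E *
   \sum_(1 <= n <oo)
     ((1 / n%:R)%:E * \sum_(n <= k <oo) (a k `^ q)%:E) `^ (1 / q))%E.
Proof.
move=> p a _ a0.
have q0 : 0 < q by lra.
have p1 : 1 <= p by rewrite /p ler_pdivlMr; lra.
have pq : p^-1 + q^-1 = 1 by rewrite /p; field; lra.
set C := 2 * (2 * p - 1) `^ (- (1 / p)).
have C0 : 0 <= C by rewrite mulr_ge0 ?powR_ge0.
apply: lime_le.
  by apply: is_cvg_nneseries => n n1 _; rewrite lee_fin a0.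
apply: nearW => N.
(* The left-hand sum now stops at [N]; stopping the outer right-hand sum there
   only decreases it. *)
apply: (@le_trans _ _ (C%:E *
   \sum_(1 <= n < N)
     ((1 / n%:R)%:E * \sum_(n <= k <oo) (a k `^ q)%:E) `^ (1 / q))%E); last first.
  rewrite lee_wpmul2l ?lee_fin//.
  by apply: nneseries_lim_ge => n _ _; exact: poweR_ge0.
rewrite sumEFin sum_eq_weighted_tails -sumEFin ge0_sume_distrr; last first.
  by move=> n _; exact: poweR_ge0.
rewrite big_nat_cond [leRHS]big_nat_cond; apply: lee_sum => n /andP[/andP[n1 _] _].
apply: (@le_trans _ _ ((C *
    (n%:R^-1 * \sum_(n <= k < N) a k `^ q) `^ q^-1)%:E)).
  rewrite lee_fin /C div1r; apply: sum_tail_weight_le => // k nk.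
  by rewrite a0// (leq_trans n1 nk).
rewrite !div1r EFinM lee_wpmul2l ?lee_fin// -poweR_EFin.
have T0 : 0 <= \sum_(n <= k < N) a k `^ q.
  by apply: sumr_ge0 => k _; exact: powR_ge0.
apply: gt0_ler_poweR; rewrite ?invr_ge0 ?(ltW q0)//.
- by rewrite in_itv/= leey andbT lee_fin mulr_ge0 ?invr_ge0.
- rewrite in_itv/= leey andbT mule_ge0 ?lee_fin ?invr_ge0//.
  by apply: nneseries_ge0 => k _ _; rewrite lee_fin powR_ge0.
rewrite EFinM lee_wpmul2l ?lee_fin ?invr_ge0// -sumEFin.
by apply: nneseries_lim_ge => k _ _; rewrite lee_fin powR_ge0.
Qed.
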